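(* Let $(N,[\nabla])$ be an $n$-dimensional projective structure with representative torsion-free connection $\nabla$, and let $\Lambda\neq 0$ be a real constant. Let $M$ be the associated $2n$-dimensional manifold with local coordinates $(x^A,z_A)$, $A=0,\dots,n-1$, carrying the metric $$g_\Lambda = dz_A\odot dx^A-\left(\Gamma^C_{AB}z_C-\Lambda z_Az_B-\Lambda^{-1}P_{AB}\right)dx^A\odot dx^B ,$$ and let $$\mathcal{A}=z_A\,dx^A-\frac{\Gamma^C_{AC}}{\Lambda(n+1)}\,dx^A .$$ Then the metric $$\mathcal{G}_\Lambda=g_\Lambda-\Lambda\left(\frac{dt}{\Lambda}+\mathcal{A}\right)^2$$ on a principal circle bundle $\sigma:\mathcal{Q}\to M$ (with fibre coordinate $t$ in a local trivialisation) is Einstein, with Ricci scalar $2n(2n+1)\Lambda$.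
   Context: A projective structure $[\nabla]$ on an $n$-manifold $N$ ($n\ge 2$) is an equivalence class of torsion-free affine connections on $TN$ sharing the same unparametrised geodesics. $\Gamma^C_{AB}$ are the connection components of a chosen $\nabla\in[\nabla]$ in local coordinates $x^A$ on $N$. $P_{AB}=\frac{1}{n-1}R_{(AB)}+\frac{1}{n+1}R_{[AB]}$ is the projective Schouten tensor, where $R_{AB}$ is the (not necessarily symmetric) Ricci tensor of $\nabla$, with index convention $R_{AB}=\partial_C\Gamma^C_{AB}-\partial_A\Gamma^C_{CB}+\Gamma^C_{CD}\Gamma^D_{AB}-\Gamma^C_{AD}\Gamma^D_{CB}$. The manifold $M$ is identified, by the choice of $\nabla$, with $T^*N$ with local coordinates $(x^A,z_A)$, where $z_A$ are the fibre coordinates. The symbol $\odot$ denotes the symmetric product $a\odot b=\frac12(a\otimes b+b\otimes a)$; repeated indices are summed over $0,\dots,n-1$. The one-form $\mathcal A$ is a potential, $\Omega_\Lambda=d\mathcal{A}$, for the symplectic form $\Omega_\Lambda=dz_A\wedge dx^A+\Lambda^{-1}P_{AB}\,dx^A\wedge dx^B$ on $M$, and $\mathcal A$ gives in the local trivialisation the connection on $\mathcal Q$ whose curvature is the pull-back of $\Omega_\Lambda$. Einstein means that the Ricci tensor is a constant multiple of the metric. *)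

(* Defs.v *)
From HB Require Import structures.
From mathcomp Require Import all_boot all_order all_algebra.
From mathcomp Require Import all_classical all_reals all_analysis.

Set Implicit Arguments.
Unset Strict Implicit.
Unset Printing Implicit Defensive.

Import Order.TTheory GRing.Theory Num.Theory.
Import numFieldNormedType.Exports.

Local Open Scope classical_set_scope.
Local Open Scope ring_scope.

Definition partial (R : realType) (m : nat) (i : 'I_m) (f : 'rV[R]_m -> R) :
  'rV[R]_m -> R := fun x => 'D_(delta_mx 0 i) f x.

(* [U] is open in every use below. *)
Fixpoint Ck (R : realType) (m k : nat) (U : set 'rV[R]_m) (f : 'rV[R]_m -> R) :
  Prop :=
  (forall x, U x -> {for x, continuous f}) /\
  match k with
  | 0 => True
  | k'.+1 => forall i, (forall x, U x -> derivable f x (delta_mx 0 i)) /\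
                       Ck k' U (partial i f)
  end.

Definition smooth_on (R : realType) (m : nat) (U : set 'rV[R]_m)
  (f : 'rV[R]_m -> R) : Prop := forall k, Ck k U f.

(* A smooth m-manifold with a chosen atlas.  [uncoord i] inverts the chart
   [coord i] on its image; the values of these maps outside [cdom i],
   respectively outside the image, are junk. *)
Record manifold (R : realType) (m : nat) := Manifold {
  points :> topologicalType;
  points_hausdorff : hausdorff_space points;
  points_second_countable : @second_countable points;
  chart_index : Type;
  cdom : chart_index -> set points;
  coord : chart_index -> points -> 'rV[R]_m;
  uncoord : chart_index -> 'rV[R]_m -> points;
  cdom_open : forall i, open (cdom i);
  cdom_cover : forall p, exists i, cdom i p;
  cimg_open : forall i, open (coord i @` cdom i);
  coordK : forall i p, cdom i p -> uncoord i (coord i p) = p;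
  coord_continuous : forall i p, cdom i p -> {for p, continuous (coord i)};
  uncoord_continuous : forall i v, (coord i @` cdom i) v ->
    {for v, continuous (uncoord i)};
  trans_smooth : forall i j b,
    smooth_on (coord i @` (cdom i `&` cdom j))
      (fun v => coord j (uncoord i v) 0 b) }.

Arguments chart_index {R m} _.
Arguments cdom {R m _} i.
Arguments coord {R m _} i p.
Arguments uncoord {R m _} i v.

Definition cimg (R : realType) (m : nat) (X : manifold R m) (i : chart_index X) :
  set 'rV[R]_m := coord i @` cdom i.

Definition overlap (R : realType) (m : nat) (X : manifold R m)
  (i j : chart_index X) : set 'rV[R]_m := coord i @` (cdom i `&` cdom j).

Definition transition (R : realType) (m : nat) (X : manifold R m)
  (i j : chart_index X) : 'rV[R]_m -> 'rV[R]_m := fun v => coord j (uncoord i v).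

(* The (a, b) entry is d y^b / d x^a, where y = transition i j x. *)
Definition jacobian (R : realType) (m : nat) (X : manifold R m)
  (i j : chart_index X) (v : 'rV[R]_m) : 'M[R]_m :=
  \matrix_(a, b) partial a (fun w => transition i j w 0 b) v.

Record one_form (R : realType) (m : nat) (X : manifold R m) := OneForm {
  form_comp : chart_index X -> 'rV[R]_m -> 'rV[R]_m;
  form_smooth : forall i a, smooth_on (cimg i) (fun v => form_comp i v 0 a);
  form_trans : forall i j v, overlap i j v ->
    form_comp i v = form_comp j (transition i j v) *m (jacobian i j v)^T }.

Record sym_tensor (R : realType) (m : nat) (X : manifold R m) := SymTensor {
  tensor_comp : chart_index X -> 'rV[R]_m -> 'M[R]_m;
  tensor_sym : forall i v, cimg i v -> (tensor_comp i v)^T = tensor_comp i v;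
  tensor_smooth : forall i a b, smooth_on (cimg i) (fun v => tensor_comp i v a b);
  tensor_trans : forall i j v, overlap i j v ->
    tensor_comp i v =
      jacobian i j v *m tensor_comp j (transition i j v) *m (jacobian i j v)^T }.

Definition nondegenerate_metric (R : realType) (m : nat) (X : manifold R m)
  (G : sym_tensor X) : Prop :=
  forall i v, cimg i v -> tensor_comp G i v \in unitmx.

(* Components of an affine connection in one chart: [Gam x C A B] stands for
   Gamma^C_{AB}(x). *)
Definition christoffel (R : realType) (m : nat) :=
  'rV[R]_m -> 'I_m -> 'I_m -> 'I_m -> R.

(* R_{AB} = d_C Gamma^C_{AB} - d_A Gamma^C_{CB}
            + Gamma^C_{CD} Gamma^D_{AB} - Gamma^C_{AD} Gamma^D_{CB} *)
Definition ricci (R : realType) (m : nat) (Gam : christoffel R m)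
  (x : 'rV[R]_m) : 'M[R]_m :=
  \matrix_(A, B)
   (\sum_C partial C (fun y => Gam y C A B) x
    - \sum_C partial A (fun y => Gam y C C B) x
    + \sum_C \sum_D Gam x C C D * Gam x D A B
    - \sum_C \sum_D Gam x C A D * Gam x D C B).

Definition schouten (R : realType) (n : nat) (Gam : christoffel R n)
  (x : 'rV[R]_n) : 'M[R]_n :=
  let Rc := ricci Gam x in
  (n%:R - 1)^-1 *: (2^-1 *: (Rc + Rc^T)) +
  (n%:R + 1)^-1 *: (2^-1 *: (Rc - Rc^T)).

Definition levi_civita (R : realType) (m : nat) (g : 'rV[R]_m -> 'M[R]_m) :
  christoffel R m := fun x k i j =>
  2^-1 * \sum_l invmx (g x) k l *
    (partial i (fun y => g y l j) x + partial j (fun y => g y i l) x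
     - partial l (fun y => g y i j) x).

Definition metric_ricci (R : realType) (m : nat) (X : manifold R m)
  (G : sym_tensor X) (i : chart_index X) (v : 'rV[R]_m) : 'M[R]_m :=
  ricci (levi_civita (tensor_comp G i)) v.

Definition ricci_scalar (R : realType) (m : nat) (X : manifold R m)
  (G : sym_tensor X) (i : chart_index X) (v : 'rV[R]_m) : R :=
  \tr (invmx (tensor_comp G i v) *m metric_ricci G i v).

Definition einstein (R : realType) (m : nat) (X : manifold R m)
  (G : sym_tensor X) : Prop :=
  exists c : R, forall i v, cimg i v ->
    metric_ricci G i v = c *: tensor_comp G i v.

Record affine_connection (R : realType) (n : nat) (N : manifold R n) :=
 AffineConnection {
  gam : chart_index N -> christoffel R n;
  gam_smooth : forall i C A B, smooth_on (cimg i) (fun x => gam i x C A B);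
  gam_trans : forall (i j : chart_index N) x, overlap i j x -> forall C A B,
    partial A (partial B (fun y => transition i j y 0 C)) x =
      \sum_D gam i x D A B * jacobian i j x D C
      - \sum_D \sum_E gam j (transition i j x) C D E
                      * jacobian i j x A D * jacobian i j x B E }.

Definition torsion_free (R : realType) (n : nat) (N : manifold R n)
  (D : affine_connection N) : Prop :=
  forall i x, cimg i x -> forall C A B, gam D i x C A B = gam D i x C B A.

Definition open_interval (R : realType) (J : set R) : Prop :=
  open J /\ is_interval J.

Definition geodesic (R : realType) (n : nat) (N : manifold R n)
  (D : affine_connection N) (J : set R) (c : R -> N) : Prop :=
  forall s, J s -> {for s, continuous c} /\
    forall i, cdom i (c s) ->
    let u := fun (A : 'I_n) (r : R) => coord i (c r) 0 A in
    (forall A, derivable (u A) s 1 /\ derivable (derive1 (u A)) s 1) /\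
    (forall C, derive1n 2 (u C) s +
       \sum_A \sum_B gam D i (coord i (c s)) C A B
                     * derive1 (u A) s * derive1 (u B) s = 0).

Definition reparametrisation (R : realType) (J' J : set R) (h : R -> R) :
  Prop :=
  [/\ open_interval J', h @` J' = J
    & forall s, J' s -> derive1 h s != 0 /\
        forall k, derivable (derive1n k h) s 1].

Definition geodesics_subsumed (R : realType) (n : nat) (N : manifold R n)
  (D D' : affine_connection N) : Prop :=
  forall J c, open_interval J -> geodesic D J c ->
  exists J' h, reparametrisation J' J h /\ geodesic D' J' (c \o h).

Definition projectively_equivalent (R : realType) (n : nat)
  (N : manifold R n) (D D' : affine_connection N) : Prop :=
  geodesics_subsumed D D' /\ geodesics_subsumed D' D.

Definition projective_structure (R : realType) (n : nat) (N : manifold R n)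
  (S : set (affine_connection N)) : Prop :=
  exists2 D0, torsion_free D0 &
    S = [set D | torsion_free D /\ projectively_equivalent D0 D].

(* [M] is the cotangent bundle of [N]: over the chart [i] of [N] it has the
   chart [ctidx i] with coordinates [row_mx x z], the fibre coordinates z
   changing like the components of a covector. *)
Record cotangent_bundle (R : realType) (n : nat) (N : manifold R n)
  (M : manifold R (n + n)) := CotangentBundle {
  ctproj : M -> N;
  ctidx : chart_index N -> chart_index M;
  ctdomE : forall i, cdom (ctidx i) = ctproj @^-1` cdom i;
  ctimgE : forall i, cimg (ctidx i) = [set v | cimg i (lsubmx v)];
  ct_base : forall i p, cdom i (ctproj p) ->
    lsubmx (coord (ctidx i) p) = coord i (ctproj p);
  ct_fibre : forall i j p, cdom i (ctproj p) -> cdom j (ctproj p) ->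
    rsubmx (coord (ctidx i) p) =
      rsubmx (coord (ctidx j) p) *m (jacobian i j (coord i (ctproj p)))^T }.

Definition fibre_coord (R : realType) (k : nat) (v : 'rV[R]_(k + 1)) : R :=
  rsubmx v 0 0.

(* A principal bundle over [M = T^*N] whose group is the circle R / period Z,
   the action being written as an action of R.  The atlas of the total space
   consists of local trivialisations over the open sets [tbase j], which lie
   in a coordinate patch [tidx j] of [N].  In such a trivialisation the fibre
   coordinate t is an angle, so a chart only sees t in an interval of length
   [period] (the fibre minus one point); different choices of the cut [tcut]
   cover the fibre. *)
Record circle_bundle (R : realType) (n : nat) (N : manifold R n)
  (M : manifold R (n + n)) (cM : cotangent_bundle N M)
  (Q : manifold R (n + n + 1)) := CircleBundle {
  bproj : Q -> M;
  bproj_surj : forall p, exists q, bproj q = p;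
  period : R;
  period_gt0 : 0 < period;
  circle_act : R -> Q -> Q;
  circle_act0 : forall q, circle_act 0 q = q;
  circle_actD : forall s s' q, circle_act (s + s') q = circle_act s (circle_act s' q);
  circle_act_fibre : forall q q', bproj q = bproj q' <-> exists s, q' = circle_act s q;
  circle_act_stab : forall q s, circle_act s q = q <-> exists k : int, s = k%:~R * period;
  tidx : chart_index Q -> chart_index N;
  tbase : chart_index Q -> set M;
  tcut : chart_index Q -> R;
  tbase_open : forall j, open (tbase j);
  tbase_sub : forall j, tbase j `<=` cdom (ctidx cM (tidx j));
  tdom_base : forall j q, cdom j q -> tbase j (bproj q);
  timgE : forall j, cimg j =
    [set v | (coord (ctidx cM (tidx j)) @` tbase j) (lsubmx v) /\
             tcut j < fibre_coord v < tcut j + period];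
  t_base : forall j q, cdom j q ->
    lsubmx (coord j q) = coord (ctidx cM (tidx j)) (bproj q);
  t_equivariant : forall j q s, cdom j q -> cdom j (circle_act s q) ->
    exists k : int, fibre_coord (coord j (circle_act s q)) =
                    fibre_coord (coord j q) + s + k%:~R * period }.

Definition dx (R : realType) (n : nat) (A : 'I_n) : 'rV[R]_(n + n) :=
  delta_mx 0 (lshift n A).

Definition dz (R : realType) (n : nat) (A : 'I_n) : 'rV[R]_(n + n) :=
  delta_mx 0 (rshift n A).

Definition dt (R : realType) (n : nat) : 'rV[R]_(n + n + 1) :=
  delta_mx 0 (rshift (n + n) 0).

Definition odot (R : realType) (m : nat) (a b : 'rV[R]_m) : 'M[R]_m :=
  2^-1 *: (a^T *m b + b^T *m a).

Definition g_Lambda (R : realType) (n : nat) (Lambda : R)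
  (Gam : christoffel R n) (x z : 'rV[R]_n) : 'M[R]_(n + n) :=
  \sum_A odot (dz R A) (dx R A)
  - \sum_A \sum_B (\sum_C Gam x C A B * z 0 C
                   - Lambda * z 0 A * z 0 B
                   - Lambda^-1 * schouten Gam x A B) *: odot (dx R A) (dx R B).

Definition potential (R : realType) (n : nat) (Lambda : R)
  (Gam : christoffel R n) (x z : 'rV[R]_n) : 'rV[R]_(n + n) :=
  \sum_A z 0 A *: dx R A
  - \sum_A (\sum_C Gam x C A C / (Lambda * (n%:R + 1))) *: dx R A.

(* Pull-backs to the total space, with coordinates [row_mx (row_mx x z) t]. *)
Definition pull_form (R : realType) (k : nat) (a : 'rV[R]_k) :
  'rV[R]_(k + 1) := row_mx a 0.

Definition pull_tensor (R : realType) (k : nat) (g : 'M[R]_k) :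
  'M[R]_(k + 1) := block_mx g 0 0 0.

(* Main.v *)
Require Import Defs.
From mathcomp Require Import all_boot all_order all_algebra.
From mathcomp Require Import all_classical all_reals all_analysis.
From mathcomp Require Import ring.
Import Order.TTheory GRing.Theory Num.Theory.
Import numFieldNormedType.Exports.
Local Open Scope classical_set_scope.
Local Open Scope ring_scope.
Set Implicit Arguments.
Unset Strict Implicit.
Unset Printing Implicit Defensive.

(** The statement is local: over each chart of [Q] the three tensors are given
    by explicit formulas in the coordinates (x^A, z_A, t), and the image of
    a chart is open, so the Levi-Civita connection and its Ricci tensor can be
    computed from these formulas.

    The computation is short because of a cancellation.  Subtracting
    Lambda (dt/Lambda + A)^2 removes the term Lambda z_A z_B from the metric,
    which becomes affine in the fibre coordinates.  With
    a_A = Gamma^C_AC / (Lambda (n + 1)) and b_A = a_A - z_A it reads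
<<
      dz_A . dx^A + h_AB dx^A . dx^B + 2 b_A dx^A . dt - dt^2 / Lambda,
      h_AB = - (Gt^C_AB z_C + W_AB),
      Gt^C_AB = Gamma^C_AB - Lambda (delta^C_A a_B + delta^C_B a_A),
      W_AB = Lambda a_A a_B - P_(AB) / Lambda.
>>
    Here Gt is again a connection of the projective class, and the choice of
    the potential A is exactly the one which makes its trace Gt^C_CA vanish.
    A metric of this shape has a constant determinant and an inverse
    polynomial in z ([nf_matrixK]), its Christoffel symbols have zero trace
    ([nf_christoffel_trace]), and the Ricci tensor of any trace-free
    connection collapses to d_k G^k_ij - G^k_il G^l_kj
    ([ricci_trace_free]).  Evaluating the two terms ([nf_divergence],
    [nf_quadratic_value]) gives 2 n Lambda times the metric in every component,
    except that the (x^A, x^B) component still contains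
    2 (Ric(Gt)_AB - (n - 1) Lambda (d_(A a_B) - a_C Gt^C_AB - W_AB)).

    This last bracket vanishes by the transformation law of the projective
    Schouten tensor under Gamma -> Gt, the projective change with one-form
    -Lambda a ([ricci_special_gam]); it is here that the coefficient
    -P_(AB) / Lambda in W is used.  The Einstein constant is 2 n Lambda, and the
    dimension 2 n + 1 gives the scalar curvature. *)

(** * Partial derivatives *)

Section PartialDerivatives.
Variables (R : realType) (m : nat).
Implicit Types (f g : 'rV[R]_m -> R) (v d : 'rV[R]_m).

Lemma is_derive_add f g v d df dg : is_derive v d f df -> is_derive v d g dg ->
  is_derive v d (fun y => f y + g y) (df + dg).
Proof. by move=> hf hg; exact: is_deriveD. Qed.

Lemma is_derive_opp f v d df : is_derive v d f df ->
  is_derive v d (fun y => - f y) (- df).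
Proof. by move=> hf; exact: is_deriveN. Qed.

Lemma is_derive_mul f g v d df dg : is_derive v d f df -> is_derive v d g dg ->
  is_derive v d (fun y => f y * g y) (f v * dg + g v * df).
Proof. by move=> hf hg; exact: is_deriveM. Qed.

Lemma is_derive_scale (c : R) f v d df : is_derive v d f df ->
  is_derive v d (fun y => c * f y) (c * df).
Proof. by move=> hf; exact: (is_deriveZ c). Qed.

Lemma is_derive_scaler (c : R) f v d df : is_derive v d f df ->
  is_derive v d (fun y => f y * c) (df * c).
Proof.
move=> /(is_derive_scale c); rewrite mulrC.
by congr is_derive; apply/funext => y; rewrite mulrC.
Qed.

Lemma is_derive_bigsum p (h : 'I_p -> 'rV[R]_m -> R) v d dh :
  (forall i, is_derive v d (h i) (dh i)) ->
  is_derive v d (fun y => \sum_i h i y) (\sum_i dh i).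
Proof.
move=> hh; have := is_derive_sum hh.
by congr is_derive; apply/funext => y; rewrite fct_sumE.
Qed.

Lemma is_derive_const (c : R) v d : is_derive v d (fun=> c) 0.
Proof. exact: is_derive_cst. Qed.

Lemma is_derive_partial i f v : derivable f v (delta_mx 0 i) ->
  is_derive v (delta_mx 0 i) f (partial i f v).
Proof. by move=> /derivableP. Qed.

Lemma partialE i f v df : is_derive v (delta_mx 0 i) f df -> partial i f v = df.
Proof. by move=> hf; rewrite /partial derive_val. Qed.

Lemma partial_local (U : set 'rV[R]_m) i f g v : open U -> U v ->
  (forall y, U y -> f y = g y) -> partial i f v = partial i g v.
Proof.
move=> oU Uv fg; apply: near_eq_derive.
by near=> y; apply: fg; near: y; exact: open_nbhs_nbhs.
Unshelve. all: by end_near. Qed.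

End PartialDerivatives.

(** Only directional derivatives are known to exist, not differentials; along a
    linear map they still pull back, because the difference quotients agree. *)
Section LinearReparametrisation.
Variables (R : realType) (m p : nat) (X : {linear 'rV[R]_m -> 'rV[R]_p}).
Implicit Types (v d : 'rV[R]_m) (f : 'rV[R]_p -> R).

Lemma quotient_linear f v d :
  (fun h : R => h^-1 *: (((fun y => f (X y)) \o shift v) (h *: d) - f (X v))) =
  (fun h : R => h^-1 *: ((f \o shift (X v)) (h *: X d) - f (X v))).
Proof. by apply/funext => h /=; rewrite (linearD X) (linearZ_LR X). Qed.

Lemma is_derive_linear f v d df : is_derive (X v) (X d) f df ->
  is_derive v d (fun y => f (X y)) df.
Proof.
move=> [hd he]; split.
- by rewrite /derivable quotient_linear.
- by rewrite -he /derive quotient_linear.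
Qed.

(** A function of [X y] is constant along the kernel of [X], so this holds for
    arbitrary [f]. *)
Lemma is_derive_transverse f v d : X d = 0 ->
  is_derive v d (fun y => f (X y)) 0.
Proof. by move=> Xd0; apply: is_derive_linear; rewrite Xd0; exact: is_derive0. Qed.

End LinearReparametrisation.

(** * The Ricci tensor of a connection *)

Section RicciLocal.
Variables (R : realType) (m : nat).

Lemma ricci_local (U : set 'rV[R]_m) (Gam Gam' : christoffel R m) v :
  open U -> U v ->
  (forall y, U y -> forall k i j, Gam y k i j = Gam' y k i j) ->
  ricci Gam v = ricci Gam' v.
Proof.
move=> oU Uv E; have dE l k i j :
    partial l (fun y => Gam y k i j) v = partial l (fun y => Gam' y k i j) v.
  by apply: (@partial_local _ _ U) => // y Uy; exact: E.
apply/matrixP => i j; rewrite !mxE.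
under eq_bigr do rewrite dE; under [X in _ - X + _]eq_bigr do rewrite dE.
congr (_ - _ + _ - _); apply: eq_bigr => k _; apply: eq_bigr => l _;
  by rewrite !E.
Qed.

End RicciLocal.

Section TraceFree.
Variables (R : realType) (m : nat) (Gam : christoffel R m).

(** Half of the terms of the Ricci tensor come from the trace
    [Gamma^k_kj], the logarithmic derivative of a density; when the connection
    preserves the coordinate volume they all drop out. *)
Lemma ricci_trace_free (U : set 'rV[R]_m) v : open U -> U v ->
  (forall y j, U y -> \sum_k Gam y k k j = 0) ->
  (forall i j k, derivable (fun y => Gam y k k j) v (delta_mx 0 i)) ->
  forall i j, ricci Gam v i j =
    \sum_k partial k (fun y => Gam y k i j) v
    - \sum_k \sum_l Gam v k i l * Gam v l k j.
Proof.
move=> oU Uv tr0 dGam i j; rewrite mxE.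
have -> : \sum_k partial i (fun y => Gam y k k j) v = 0.
  have <- : partial i (fun y => \sum_k Gam y k k j) v =
            \sum_k partial i (fun y => Gam y k k j) v.
    apply: partialE; apply: is_derive_bigsum => k.
    by apply: is_derive_partial; exact: dGam.
  rewrite (@partial_local _ _ U i _ (fun=> 0)) //.
    by apply: partialE; exact: is_derive_const.
  by move=> y Uy; exact: tr0.
have -> : \sum_k \sum_l Gam v k k l * Gam v l i j = 0.
  rewrite exchange_big big1 // => l _.
  by rewrite -mulr_suml tr0 // mul0r.
by rewrite subr0 addr0.
Qed.

End TraceFree.

(** * Indices and coordinates (x, z, t) *)

Section Coordinates.
Variable n : nat.

Definition ix (A : 'I_n) : 'I_(n + n + 1) := lshift 1 (lshift n A).
Definition iz (A : 'I_n) : 'I_(n + n + 1) := lshift 1 (rshift n A).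
Definition it : 'I_(n + n + 1) := rshift (n + n) (0 : 'I_1).

(** The same indices as a sum type: tables of tensor components are then defined
    by matching and evaluated by computation, also under a big sum. *)
Variant frame := Fx of 'I_n | Fz of 'I_n | Ft.

Definition index_of (K : frame) : 'I_(n + n + 1) :=
  match K with Fx A => ix A | Fz A => iz A | Ft => it end.

Definition frame_of (k : 'I_(n + n + 1)) : frame :=
  match fintype.split k with
  | inl k' => match fintype.split k' with inl A => Fx A | inr A => Fz A end
  | inr _ => Ft
  end.

Lemma index_ofK : cancel index_of frame_of.
Proof.
rewrite /frame_of; case=> [A|A|] /=.
- by rewrite (unsplitK (inl (lshift n A))) (unsplitK (inl A)).
- by rewrite (unsplitK (inl (rshift n A))) (unsplitK (inr A)).
- by rewrite (unsplitK (inr 0)).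
Qed.

Lemma frame_ofK : cancel frame_of index_of.
Proof.
move=> k; rewrite /frame_of; case: (split_ordP k) => [k' ->|k' ->].
  by case: (split_ordP k') => A ->.
by rewrite (ord1 k').
Qed.

Lemma frame_of_x A : frame_of (ix A) = Fx A.
Proof. exact: (index_ofK (Fx A)). Qed.

Lemma frame_of_z A : frame_of (iz A) = Fz A.
Proof. exact: (index_ofK (Fz A)). Qed.

Lemma frame_of_t : frame_of it = Ft.
Proof. exact: (index_ofK Ft). Qed.

Lemma sum_frame (V : nmodType) (F : frame -> V) :
  \sum_k F (frame_of k) = \sum_A F (Fx A) + \sum_A F (Fz A) + F Ft.
Proof.
rewrite !big_split_ord big_ord1 frame_of_t; congr (_ + _ + _);
  by apply: eq_bigr => A _; rewrite ?frame_of_x ?frame_of_z.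
Qed.

End Coordinates.
Arguments Fx {n}.
Arguments Fz {n}.
Arguments Ft {n}.
Arguments it {n}.

Section SumDelta.
Variables (R : pzRingType) (n : nat).
Implicit Types (F : 'I_n -> R) (A B : 'I_n).

Lemma sum_single A F : (forall B, B != A -> F B = 0) -> \sum_B F B = F A.
Proof. by move=> F0; rewrite (bigD1 A) //= big1 ?addr0. Qed.

Lemma sum_mul0l F : \sum_A 0 * F A = 0.
Proof. by rewrite big1 // => A _; rewrite mul0r. Qed.

Lemma sum_mul0r F : \sum_A F A * 0 = 0.
Proof. by rewrite big1 // => A _; rewrite mulr0. Qed.

Lemma sum2_mul0l (F : 'I_n -> 'I_n -> R) : \sum_A \sum_B 0 * F A B = 0.
Proof. by rewrite big1 // => A _; rewrite sum_mul0l. Qed.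

Lemma sum2_mul0r (F : 'I_n -> 'I_n -> R) : \sum_A \sum_B F A B * 0 = 0.
Proof. by rewrite big1 // => A _; rewrite sum_mul0r. Qed.

Definition sum_mul0 := (sum_mul0l, sum_mul0r, sum2_mul0l, sum2_mul0r).

Lemma sum_deltar F A : \sum_B F B * (B == A)%:R = F A.
Proof.
rewrite (sum_single (A := A)) ?eqxx ?mulr1 // => B /negPf ->.
by rewrite mulr0.
Qed.

Lemma sum_deltarC F A : \sum_B F B * (A == B)%:R = F A.
Proof. by under eq_bigr do rewrite eq_sym; exact: sum_deltar. Qed.

Lemma sum_deltal F A : \sum_B (B == A)%:R * F B = F A.
Proof.
rewrite (sum_single (A := A)) ?eqxx ?mul1r // => B /negPf ->.
by rewrite mul0r.
Qed.

Lemma sum_deltalC F A : \sum_B (A == B)%:R * F B = F A.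
Proof. by under eq_bigr do rewrite eq_sym; exact: sum_deltal. Qed.

Definition sum_delta := (sum_deltar, sum_deltarC, sum_deltal, sum_deltalC).

End SumDelta.

Section CoordinateDerivatives.
Variables (R : realType) (n : nat).
Implicit Types (v d : 'rV[R]_(n + n + 1)) (f : 'rV[R]_n -> R).

Definition base_point v : 'rV[R]_n := lsubmx (lsubmx v).
Definition fibre_z v (A : 'I_n) : R := rsubmx (lsubmx v) 0 A.

Lemma base_point_dx A : base_point (delta_mx 0 (ix A)) = delta_mx 0 A.
Proof.
apply/rowP => B; rewrite !mxE /= /ix.
by rewrite (inj_eq (@lshift_inj _ _)) (inj_eq (@lshift_inj _ _)).
Qed.

Lemma base_point_dz A : base_point (delta_mx 0 (iz A)) = 0.
Proof.
apply/rowP => B; rewrite !mxE /= /iz (inj_eq (@lshift_inj _ _)).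
by rewrite eq_lrshift.
Qed.

Lemma base_point_dt : base_point (delta_mx 0 it) = 0.
Proof. by apply/rowP => B; rewrite !mxE /= /it eq_lrshift. Qed.

Lemma fibre_z_dx A B : fibre_z (delta_mx 0 (ix A)) B = 0.
Proof. by rewrite /fibre_z !mxE /= /ix (inj_eq (@lshift_inj _ _)) eq_rlshift. Qed.

Lemma fibre_z_dz A B : fibre_z (delta_mx 0 (iz A)) B = (A == B)%:R.
Proof.
rewrite /fibre_z !mxE /= /iz (inj_eq (@lshift_inj _ _)) (inj_eq (@rshift_inj _ _)).
by rewrite eq_sym.
Qed.

Lemma fibre_z_dt B : fibre_z (delta_mx 0 it) B = 0.
Proof. by rewrite /fibre_z !mxE /= /it eq_lrshift. Qed.

Lemma is_derive_base_dx A f v : derivable f (base_point v) (delta_mx 0 A) ->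
  is_derive v (delta_mx 0 (ix A)) (fun y => f (base_point y)) (partial A f (base_point v)).
Proof.
move=> df; apply: (@is_derive_linear _ _ _ (lsubmx \o lsubmx)).
by rewrite -[X in is_derive _ X]/(base_point _) base_point_dx; exact: is_derive_partial.
Qed.

Lemma is_derive_base0 f v d : base_point d = 0 ->
  is_derive v d (fun y => f (base_point y)) 0.
Proof. exact: (@is_derive_transverse _ _ _ (lsubmx \o lsubmx)). Qed.

Lemma is_derive_fibre_z v d A : is_derive v d (fun y => fibre_z y A) (fibre_z d A).
Proof.
have lim : h^-1 *: (((fibre_z ^~ A) \o shift v) (h *: d) - fibre_z v A) @[h --> 0^'] -->
           fibre_z d A.
  apply: cvg_near_cst; near=> h.
  rewrite /= /fibre_z !mxE addrK /GRing.scale /= mulKf //.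
  by near: h; exact: nbhs_dnbhs_neq.
by split; [exact: cvgP lim | exact: cvg_lim lim].
Unshelve. all: by end_near. Qed.

End CoordinateDerivatives.

(** * Metrics affine in the fibre coordinates *)

Section NormalForm.
Variables (R : realType) (n : nat) (Lam : R) (Lam_neq0 : Lam != 0).
(* The component gt^C_AB is [gt C A B]. *)
Variables (gt : 'I_n -> 'I_n -> 'I_n -> 'rV[R]_n -> R).
Variables (a : 'I_n -> 'rV[R]_n -> R) (W : 'I_n -> 'I_n -> 'rV[R]_n -> R).
Implicit Types (y v : 'rV[R]_(n + n + 1)) (A B C D : 'I_n).

Let delta A B : R := (A == B)%:R.

Definition nf_b A y := a A (base_point y) - fibre_z y A.
Definition nf_h A B y :=
  - (\sum_C gt C A B (base_point y) * fibre_z y C + W A B (base_point y)).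
(** The components along dx^A dx^B of the metric on the base of the circle
    bundle: completing the square in dt leaves h + Lam b b. *)
Definition nf_k A B y := nf_h A B y + Lam * nf_b A y * nf_b B y.
Definition nf_da D A y := partial D (a A) (base_point y).
Definition nf_dh D A B y :=
  - (\sum_C partial D (gt C A B) (base_point y) * fibre_z y C + partial D (W A B) (base_point y)).

Definition nf_metric (I J : frame n) : 'rV[R]_(n + n + 1) -> R :=
  match I, J with
  | Fx A, Fx B => nf_h A B
  | Fx A, Fz B | Fz A, Fx B => cst (2^-1 * delta A B)
  | Fx A, Ft | Ft, Fx A => nf_b A
  | Ft, Ft => cst (- Lam^-1)
  | _, _ => cst 0
  end.

Definition nf_inverse (I J : frame n) : 'rV[R]_(n + n + 1) -> R :=
  match I, J with
  | Fx A, Fz B | Fz A, Fx B => cst (2 * delta A B)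
  | Fz A, Fz B => fun y => - 4 * nf_k A B y
  | Fz A, Ft | Ft, Fz A => fun y => 2 * Lam * nf_b A y
  | Ft, Ft => cst (- Lam)
  | _, _ => cst 0
  end.

(** First derivatives: the first index is the direction of differentiation. *)
Definition nf_dmetric (K I J : frame n) : 'rV[R]_(n + n + 1) -> R :=
  match K, I, J with
  | Fx D, Fx A, Fx B => nf_dh D A B
  | Fz D, Fx A, Fx B => fun y => - gt D A B (base_point y)
  | Fx D, Fx A, Ft | Fx D, Ft, Fx A => nf_da D A
  | Fz D, Fx A, Ft | Fz D, Ft, Fx A => cst (- delta D A)
  | _, _, _ => cst 0
  end.

Definition coefs_derivable (x : 'rV[R]_n) : Prop :=
  [/\ forall D C A B, derivable (gt C A B) x (delta_mx 0 D),
      forall D A, derivable (a A) x (delta_mx 0 D)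
    & forall D A B, derivable (W A B) x (delta_mx 0 D)].

Lemma is_derive_nf_b_dx D A v : coefs_derivable (base_point v) ->
  is_derive v (delta_mx 0 (ix D)) (nf_b A) (nf_da D A v).
Proof.
move=> [_ da _]; apply: is_derive_eq.
  apply: is_derive_add; first exact: is_derive_base_dx.
  by apply: is_derive_opp; exact: is_derive_fibre_z.
by rewrite fibre_z_dx subr0.
Qed.

Lemma is_derive_nf_b_dz D A v :
  is_derive v (delta_mx 0 (iz D)) (nf_b A) (- delta D A).
Proof.
apply: is_derive_eq.
  apply: is_derive_add; first by apply: is_derive_base0; exact: base_point_dz.
  by apply: is_derive_opp; exact: is_derive_fibre_z.
by rewrite fibre_z_dz add0r.
Qed.

Lemma is_derive_nf_b_dt A v : is_derive v (delta_mx 0 it) (nf_b A) 0.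
Proof.
apply: is_derive_eq.
  apply: is_derive_add; first by apply: is_derive_base0; exact: base_point_dt.
  by apply: is_derive_opp; exact: is_derive_fibre_z.
by rewrite fibre_z_dt subr0.
Qed.

Lemma is_derive_nf_h_dx D A B v : coefs_derivable (base_point v) ->
  is_derive v (delta_mx 0 (ix D)) (nf_h A B) (nf_dh D A B v).
Proof.
move=> [dgt _ dW]; apply: is_derive_eq.
  apply: is_derive_opp; apply: is_derive_add; last exact: is_derive_base_dx.
  apply: is_derive_bigsum => C; apply: is_derive_mul.
    exact: is_derive_base_dx.
  exact: is_derive_fibre_z.
rewrite /nf_dh; congr (- (_ + _)); apply: eq_bigr => C _.
by rewrite fibre_z_dx mulr0 add0r mulrC.
Qed.

Lemma is_derive_nf_h_dz D A B v :
  is_derive v (delta_mx 0 (iz D)) (nf_h A B) (- gt D A B (base_point v)).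
Proof.
apply: is_derive_eq.
  apply: is_derive_opp; apply: is_derive_add; last first.
    by apply: is_derive_base0; exact: base_point_dz.
  apply: is_derive_bigsum => C; apply: is_derive_mul.
    by apply: is_derive_base0; exact: base_point_dz.
  exact: is_derive_fibre_z.
rewrite addr0 (sum_single (A := D)) => [|C CD].
  by rewrite fibre_z_dz eqxx mulr1 mulr0 addr0.
by rewrite fibre_z_dz eq_sym (negPf CD) !mulr0 addr0.
Qed.

Lemma is_derive_nf_h_dt A B v : is_derive v (delta_mx 0 it) (nf_h A B) 0.
Proof.
apply: is_derive_eq.
  apply: is_derive_opp; apply: is_derive_add; last first.
    by apply: is_derive_base0; exact: base_point_dt.
  apply: is_derive_bigsum => C; apply: is_derive_mul.
    by apply: is_derive_base0; exact: base_point_dt.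
  exact: is_derive_fibre_z.
rewrite addr0 big1 ?oppr0 // => C _.
by rewrite fibre_z_dt !mulr0 addr0.
Qed.

Lemma is_derive_nf_metric v : coefs_derivable (base_point v) -> forall K I J,
  is_derive v (delta_mx 0 (index_of K)) (nf_metric I J) (nf_dmetric K I J v).
Proof.
move=> dc [D|D|] [A|A|] [B|B|] /=; try exact: is_derive_const.
- exact: is_derive_nf_h_dx.
- exact: is_derive_nf_b_dx.
- exact: is_derive_nf_b_dx.
- exact: is_derive_nf_h_dz.
- exact: is_derive_nf_b_dz.
- exact: is_derive_nf_b_dz.
- exact: is_derive_nf_h_dt.
- exact: is_derive_nf_b_dt.
- exact: is_derive_nf_b_dt.
Qed.

(** The rows of the inverse matrix, as a rule for raising an index. *)
Lemma nf_raise (F : frame n -> R) v K :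
  \sum_l nf_inverse K (frame_of l) v * F (frame_of l) =
  match K with
  | Fx C => 2 * F (Fz C)
  | Fz C => 2 * F (Fx C) - 4 * (\sum_D nf_k C D v * F (Fz D))
            + 2 * Lam * nf_b C v * F Ft
  | Ft => 2 * Lam * (\sum_D nf_b D v * F (Fz D)) - Lam * F Ft
  end.
Proof.
rewrite (sum_frame (fun J => nf_inverse K J v * F J)); case: K => [C|C|] /=.
- rewrite big1 => [|D _]; last by rewrite mul0r.
  rewrite (sum_single (A := C)) => [|D DC]; rewrite /delta.
    by rewrite eqxx mulr1 mul0r add0r addr0.
  by rewrite eq_sym (negPf DC) mulr0 mul0r.
- rewrite (sum_single (A := C)) => [|D DC]; rewrite /delta; last first.
    by rewrite eq_sym (negPf DC) mulr0 mul0r.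
  rewrite eqxx mulr1; congr (_ + _ + _).
  by rewrite -mulNr mulr_sumr; apply: eq_bigr => D _; rewrite mulrA.
- rewrite big1 => [|D _]; last by rewrite mul0r.
  rewrite add0r mulNr; congr (_ - _).
  by rewrite mulr_sumr; apply: eq_bigr => D _; rewrite mulrA.
Qed.

Definition nf_matrix v : 'M[R]_(n + n + 1) :=
  \matrix_(i, k) nf_metric (frame_of i) (frame_of k) v.

Definition nf_inv_matrix v : 'M[R]_(n + n + 1) :=
  \matrix_(i, k) nf_inverse (frame_of i) (frame_of k) v.

Lemma index_of_eq (K J : frame n) : (index_of K == index_of J) =
  match K, J with
  | Fx A, Fx B | Fz A, Fz B => A == B
  | Ft, Ft => true
  | _, _ => false
  end.
Proof.
apply/eqP/idP => [/(can_inj (@index_ofK n)) <-|]; first by case: K.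
by case: K => [A|A|]; case: J => [B|B|] //= /eqP ->.
Qed.

Lemma nf_matrixK v : nf_inv_matrix v *m nf_matrix v = 1%:M.
Proof.
apply/matrixP => i k; rewrite !mxE.
under eq_bigr do rewrite !mxE.
rewrite (nf_raise (fun I => nf_metric I (frame_of k) v)).
rewrite -[i]frame_ofK -[k]frame_ofK index_of_eq !index_ofK.
case: (frame_of i) => [A|A|]; case: (frame_of k) => [B|B|] /=; rewrite ?mulr0 //.
- by rewrite mulVKf // pnatr_eq0.
- rewrite (sum_single (A := B)) => [|D DB]; rewrite /delta.
    by rewrite eqxx /nf_k ?mulr1n ?mulr0n; field.
  by rewrite (negPf DB) !mulr0.
- rewrite big1 ?mulr0 ?subr0 ?addr0 => [|D _]; last by rewrite mulr0.
  by rewrite mulVKf // pnatr_eq0.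
- rewrite big1 => [|D _]; last by rewrite mulr0.
  by rewrite mulr0n; field.
- rewrite (sum_single (A := B)) => [|D DB]; rewrite /delta.
    by rewrite eqxx /nf_k ?mulr1n ?mulr0n; field.
  by rewrite (negPf DB) !mulr0.
- rewrite big1 => [|D _]; last by rewrite mulr0.
  by rewrite !mulr0 subr0 mulr0n.
- rewrite big1 => [|D _]; last by rewrite mulr0.
  by rewrite mulr0 add0r mulrN opprK divff // mulr1n.
Qed.

Lemma nf_matrix_unit v : nf_matrix v \in unitmx.
Proof. by have /mulmx1_unit[] := nf_matrixK v. Qed.

Lemma invmx_nf_matrix v : invmx (nf_matrix v) = nf_inv_matrix v.
Proof.
by rewrite -[LHS]mul1mx -(nf_matrixK v) mulmxK // nf_matrix_unit.
Qed.

Definition nf_s A B y : R := 2^-1 * (nf_da A B y + nf_da B A y).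
Definition nf_bgam A B y : R := \sum_D nf_b D y * gt D A B (base_point y).

(** The first index is the upper one.  Symbols with an upper x index and a lower
    z index all vanish: covariant derivatives of d/dz_A have no x-component. *)
Definition nf_christoffel (K I J : frame n) : 'rV[R]_(n + n + 1) -> R :=
  match K, I, J with
  | Fx C, Fx A, Fx B => fun y => gt C A B (base_point y)
  | Fx C, Fx A, Ft | Fx C, Ft, Fx A => cst (delta C A)
  | Fz C, Fx A, Fx B => fun y =>
      nf_dh A C B y + nf_dh B A C y - nf_dh C A B y
      - 2 * (\sum_D nf_k C D y * gt D A B (base_point y))
      + 2 * Lam * nf_b C y * nf_s A B y
  | Fz C, Fx A, Fz B => fun y => - gt B A C (base_point y) - Lam * nf_b C y * delta A B
  | Fz C, Fz A, Fx B => fun y => - gt A C B (base_point y) - Lam * nf_b C y * delta A B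
  | Fz C, Fx A, Ft | Fz C, Ft, Fx A => fun y =>
      nf_da A C y - nf_da C A y - 2 * nf_k C A y
  | Fz C, Fz A, Ft | Fz C, Ft, Fz A => cst (- delta A C)
  | Ft, Fx A, Fx B => fun y => Lam * (nf_bgam A B y - nf_s A B y)
  | Ft, Fx A, Fz B | Ft, Fz A, Fx B => cst (2^-1 * Lam * delta A B)
  | Ft, Fx A, Ft | Ft, Ft, Fx A => fun y => Lam * nf_b A y
  | _, _, _ => cst 0
  end.

Lemma levi_civita_nf_matrix (U : set 'rV[R]_(n + n + 1))
  (G : 'rV[R]_(n + n + 1) -> 'M[R]_(n + n + 1)) v :
  open U -> U v -> coefs_derivable (base_point v) ->
  (forall y, U y -> G y = nf_matrix y) ->
  forall k i j, levi_civita G v k i j =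
    nf_christoffel (frame_of k) (frame_of i) (frame_of j) v.
Proof.
move=> oU Uv dc GE k i j; rewrite /levi_civita.
have dG l i' j' : partial l (fun y => G y i' j') v =
    nf_dmetric (frame_of l) (frame_of i') (frame_of j') v.
  rewrite (@partial_local _ _ U _ _ (nf_metric (frame_of i') (frame_of j'))) //.
    by apply: partialE; rewrite -{1}[l]frame_ofK; exact: is_derive_nf_metric.
  by move=> y Uy; rewrite GE // mxE.
under eq_bigr do rewrite !dG GE // invmx_nf_matrix mxE.
move: (frame_of k) (frame_of i) (frame_of j) => K I J.
rewrite (nf_raise
  (fun l => nf_dmetric I l J v + nf_dmetric J I l v - nf_dmetric l I J v)).
move: K I J => [C|C|] [A|A|] [B|B|] /=.
all: rewrite ?add0r ?addr0 ?subr0 ?sub0r ?oppr0 ?opprK ?mulr0 ?addr0 ?subr0.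
all: rewrite ?mulKf ?pnatr_eq0 //.
all: try (rewrite big1 => [|D _]; last by rewrite ?mulr0).
all: rewrite ?mulr0 ?subr0 ?mulr0 //.
- under eq_bigr do rewrite sub0r opprK.
  by rewrite /nf_s; field.
- by rewrite /delta (eq_sym B); field.
- rewrite (sum_single (A := A)) /delta => [|D /negPf ->]; last first.
    by rewrite mulr0n oppr0 subr0 mulr0.
  by rewrite eqxx mulr1n sub0r opprK mulr1; field.
- by field.
- by field.
- rewrite (sum_single (A := B)) /delta => [|D /negPf ->]; last first.
    by rewrite mulr0n oppr0 subr0 mulr0.
  by rewrite eqxx mulr1n sub0r opprK mulr1; field.
- by field.
- rewrite /nf_bgam /nf_s; under eq_bigr do rewrite sub0r opprK.
  by field.
- by rewrite /delta (eq_sym B); field.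
- rewrite (sum_single (A := A)) /delta => [|D /negPf ->]; last first.
    by rewrite mulr0n oppr0 subr0 mulr0.
  by rewrite eqxx mulr1n sub0r opprK mulr1; field.
- by field.
- rewrite (sum_single (A := B)) /delta => [|D /negPf ->]; last first.
    by rewrite mulr0n oppr0 subr0 mulr0.
  by rewrite eqxx mulr1n sub0r opprK mulr1; field.
Qed.

Lemma is_derive_nf_dh_dz E D A B v :
  is_derive v (delta_mx 0 (iz E)) (nf_dh D A B) (- partial D (gt E A B) (base_point v)).
Proof.
apply: is_derive_eq.
  apply: is_derive_opp; apply: is_derive_add; last first.
    by apply: (@is_derive_base0 _ _ (partial D (W A B))); exact: base_point_dz.
  apply: is_derive_bigsum => C; apply: is_derive_mul.
    by apply: (@is_derive_base0 _ _ (partial D (gt C A B))); exact: base_point_dz.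
  exact: is_derive_fibre_z.
rewrite addr0 (sum_single (A := E)) => [|C CE].
  by rewrite fibre_z_dz eqxx mulr1 mulr0 addr0.
by rewrite fibre_z_dz eq_sym (negPf CE) !mulr0 addr0.
Qed.

Lemma is_derive_nf_k_dz E A B v :
  is_derive v (delta_mx 0 (iz E)) (nf_k A B)
    (- gt E A B (base_point v) - Lam * (delta E A * nf_b B v + delta E B * nf_b A v)).
Proof.
apply: is_derive_eq.
  apply: is_derive_add; first exact: is_derive_nf_h_dz.
  apply: is_derive_mul; last exact: is_derive_nf_b_dz.
  by apply: is_derive_scale; exact: is_derive_nf_b_dz.
by rewrite /=; ring.
Qed.

Lemma is_derive_nf_s_dz E A B v :
  is_derive v (delta_mx 0 (iz E)) (nf_s A B) 0.
Proof.
apply: (@is_derive_base0 _ _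
  (fun x => 2^-1 * (partial A (a B) x + partial B (a A) x))).
exact: base_point_dz.
Qed.

Lemma is_derive_nf_da_dz E A B v :
  is_derive v (delta_mx 0 (iz E)) (nf_da A B) 0.
Proof. by apply: (@is_derive_base0 _ _ (partial A (a B))); exact: base_point_dz. Qed.

Lemma is_derive_gt_dz E C A B v :
  is_derive v (delta_mx 0 (iz E)) (fun y => gt C A B (base_point y)) 0.
Proof. by apply: is_derive_base0; exact: base_point_dz. Qed.

(** The derivative of the symbol with upper index [K] in the direction [K]
    itself, the only ones that occur in the divergence d_k G^k_ij.  Along z_C
    the functions W, a and their derivatives are constant, which is why no
    derivative of W survives. *)
Definition nf_dchristoffel (K I J : frame n) v : R :=
  match K, I, J with
  | Fx C, Fx A, Fx B => partial C (gt C A B) (base_point v)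
  | Fz C, Fx A, Fx B =>
      partial C (gt C A B) (base_point v) - partial A (gt C C B) (base_point v)
      - partial B (gt C A C) (base_point v)
      + 2 * (\sum_D (gt C C D (base_point v) + Lam * nf_b D v + Lam * delta C D * nf_b C v)
                    * gt D A B (base_point v))
      - 2 * Lam * nf_s A B v
  | Fz C, Fx A, Fz B | Fz C, Fz A, Fx B => Lam * delta A B
  | Fz C, Fx A, Ft | Fz C, Ft, Fx A =>
      2 * (gt C C A (base_point v) + Lam * nf_b A v + Lam * delta C A * nf_b C v)
  | _, _, _ => 0
  end.

Lemma is_derive_nf_christoffel v : coefs_derivable (base_point v) -> forall K I J,
  is_derive v (delta_mx 0 (index_of K)) (nf_christoffel K I J) (nf_dchristoffel K I J v).
Proof.
move=> [dgt da dW] [C|C|] [A|A|] [B|B|] /=; try exact: is_derive_const.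
- exact: is_derive_base_dx.
- apply: is_derive_eq.
    apply: is_derive_add; last first.
      apply: is_derive_mul; last exact: is_derive_nf_s_dz.
      by apply: is_derive_scale; exact: is_derive_nf_b_dz.
    apply: is_derive_add; last first.
      apply: is_derive_opp; apply: is_derive_scale.
      apply: is_derive_bigsum => D; apply: is_derive_mul; last first.
        exact: is_derive_gt_dz.
      exact: is_derive_nf_k_dz.
    apply: is_derive_add; last by apply: is_derive_opp; exact: is_derive_nf_dh_dz.
    by apply: is_derive_add; exact: is_derive_nf_dh_dz.
  rewrite /delta eqxx.
  have -> : \sum_i (nf_k C i v * 0 + gt i A B (base_point v) *
       (- gt C C i (base_point v) - Lam * (true%:R * nf_b i v + (C == i)%:R * nf_b C v))) =
    - \sum_D (gt C C D (base_point v) + Lam * nf_b D v + Lam * (C == D)%:R * nf_b C v)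
                    * gt D A B (base_point v).
    by rewrite -sumrN; apply: eq_bigr => i _; rewrite mulr1n /=; ring.
  rewrite mulr1n /=; ring.
- apply: is_derive_eq.
    apply: is_derive_add; first by apply: is_derive_opp; exact: is_derive_gt_dz.
    apply: is_derive_opp; apply: is_derive_scaler.
    by apply: is_derive_scale; exact: is_derive_nf_b_dz.
  by rewrite [delta C C]/delta eqxx mulr1n /=; ring.
- apply: is_derive_eq.
    apply: is_derive_add; last first.
      apply: is_derive_opp; by apply: is_derive_scale; exact: is_derive_nf_k_dz.
    apply: is_derive_add; last apply: is_derive_opp; exact: is_derive_nf_da_dz.
  by rewrite [delta C C]/delta eqxx mulr1n /=; ring.
- apply: is_derive_eq.
    apply: is_derive_add; first by apply: is_derive_opp; exact: is_derive_gt_dz.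
    apply: is_derive_opp; apply: is_derive_scaler.
    by apply: is_derive_scale; exact: is_derive_nf_b_dz.
  by rewrite [delta C C]/delta eqxx mulr1n /=; ring.
- apply: is_derive_eq.
    apply: is_derive_add; last first.
      apply: is_derive_opp; by apply: is_derive_scale; exact: is_derive_nf_k_dz.
    apply: is_derive_add; last apply: is_derive_opp; exact: is_derive_nf_da_dz.
  by rewrite [delta C C]/delta eqxx mulr1n /=; ring.
- apply: is_derive_eq.
    apply: is_derive_scale.
    apply: is_derive_add; last first.
      apply: is_derive_opp; apply: (@is_derive_base0 _ _
  (fun x => 2^-1 * (partial A (a B) x + partial B (a A) x))).
      exact: base_point_dt.
    apply: is_derive_bigsum => D; apply: is_derive_mul.
      exact: is_derive_nf_b_dt.
    by apply: is_derive_base0; exact: base_point_dt.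
  rewrite oppr0 addr0 big1 ?mulr0 // => D _.
  by rewrite !mulr0 addr0.
- apply: is_derive_eq.
    by apply: is_derive_scale; exact: is_derive_nf_b_dt.
  by rewrite mulr0.
- apply: is_derive_eq.
    by apply: is_derive_scale; exact: is_derive_nf_b_dt.
  by rewrite mulr0.
Qed.

(** This lets derivatives pass through the sum in the trace G^k_kj. *)
Lemma derivable_nf_christoffel_trace v : coefs_derivable (base_point v) -> forall d K J,
  derivable (nf_christoffel K K J) v (delta_mx 0 (index_of d)).
Proof.
move=> dc; have [dgt _ _] := dc.
have dgtx C A B d : derivable (fun y => gt C A B (base_point y)) v
    (delta_mx 0 (index_of d)).
  case: d => [D|D|] /=.
  - by have [] := is_derive_base_dx (dgt D C A B).
  - by have [] := is_derive_base0 (gt C A B) v (base_point_dz R D).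
  - by have [] := is_derive_base0 (gt C A B) v (base_point_dt R n).
have dbx A d : derivable (nf_b A) v (delta_mx 0 (index_of d)).
  by have [] := is_derive_nf_metric dc d (Fx A) Ft.
have dcst c d : derivable (cst c : 'rV[R]_(n + n + 1) -> R) v d.
  exact: derivable_cst.
move=> d [C|C|] [B|B|].
- exact: dgtx.
- exact: (dcst 0).
- exact: (dcst (delta C C)).
- have dg := is_derive_opp (derivableP (dgtx C C B d)).
  have db := is_derive_opp (is_derive_scaler (delta C B)
                              (is_derive_scale Lam (derivableP (dbx C d)))).
  by have [] := is_derive_add dg db.
- exact: (dcst 0).
- exact: (dcst (- delta C C)).
- by have [] := is_derive_scale Lam (derivableP (dbx B d)).
- exact: (dcst 0).
- exact: (dcst 0).
Qed.

(** The determinant of the metric is constant, so the trace of its Christoffel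
    symbols vanishes.  Here the z-block cancels the x-block (up to -Lam b) and
    the t-block cancels the remaining Lam b. *)
Lemma nf_christoffel_trace v : (forall A, \sum_C gt C C A (base_point v) = 0) ->
  (forall A B C, gt C A B (base_point v) = gt C B A (base_point v)) ->
  forall J, \sum_k nf_christoffel (frame_of k) (frame_of k) J v = 0.
Proof.
move=> tr0 sym J; rewrite (sum_frame (fun K => nf_christoffel K K J v)).
case: J => [A|A|] /=.
- rewrite tr0 sumrB sumrN tr0 (sum_single (A := A)) => [|C /negPf CA].
    by rewrite /delta eqxx /=; ring.
  by rewrite /delta CA mulr0.
- by rewrite !big1 // !addr0.
- by rewrite sumrN subrr addr0.
Qed.

(** The divergence term d_k G^k_ij of the Ricci tensor; the factors [n] come from
    d b_C / d z_C = -1 summed over C. *)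
Lemma nf_divergence v : (forall A, \sum_C gt C C A (base_point v) = 0) ->
  (forall A B, \sum_C partial A (gt C C B) (base_point v) = 0) ->
  (forall A B, \sum_C partial B (gt C A C) (base_point v) = 0) ->
  forall I J, \sum_K nf_dchristoffel (frame_of K) I J v =
  match I, J with
  | Fx A, Fx B =>
      2 * (\sum_C partial C (gt C A B) (base_point v))
      + 2 * Lam * (n%:R + 1) * nf_bgam A B v - 2 * n%:R * Lam * nf_s A B v
  | Fx A, Fz B | Fz A, Fx B => n%:R * Lam * delta A B
  | Fx A, Ft | Ft, Fx A => 2 * (n%:R + 1) * Lam * nf_b A v
  | _, _ => 0
  end.
Proof.
move=> tr0 dtr0 dtr0' I J; rewrite (sum_frame (fun K => nf_dchristoffel K I J v)).
have sum_b A : \sum_C 2 * (gt C C A (base_point v) + Lam * nf_b A v +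
    Lam * delta C A * nf_b C v) = 2 * (n%:R + 1) * Lam * nf_b A v.
  rewrite -mulr_sumr !big_split /= tr0 sumr_const card_ord.
  under eq_bigr do rewrite -mulrA.
  rewrite -mulr_sumr sum_delta -mulr_natl; ring.
case: I J => [A|A|] [B|B|] /=; rewrite ?big1_eq ?addr0 ?add0r //.
- rewrite !big_split /= sumrN dtr0 subr0 sumrN dtr0' subr0.
  rewrite -mulr_sumr exchange_big /=.
  rewrite !sumrN sumr_const card_ord -mulr_natl.
  suff -> : \sum_D \sum_C (gt C C D (base_point v) + Lam * nf_b D v +
      Lam * delta C D * nf_b C v) * gt D A B (base_point v) =
      (n%:R + 1) * Lam * nf_bgam A B v by ring.
  rewrite /nf_bgam mulr_sumr; apply: eq_bigr => D _; rewrite -mulr_suml.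
  have := sum_b D; rewrite -mulr_sumr => /(congr1 (fun r => 2^-1 * r)).
  by rewrite mulKf ?pnatr_eq0 // => ->; field.
- by rewrite sumr_const card_ord -mulr_natl; ring.
- by rewrite sumr_const card_ord -mulr_natl; ring.
Qed.

(** Of the nine blocks of the quadratic term those mixing x and z vanish, since
    no symbol has an upper x and a lower z index. *)
Lemma nf_quadratic_split v I J :
  \sum_k \sum_l nf_christoffel (frame_of k) I (frame_of l) v *
                nf_christoffel (frame_of l) (frame_of k) J v =
  \sum_C \sum_D nf_christoffel (Fx C) I (Fx D) v * nf_christoffel (Fx D) (Fx C) J v
  + \sum_C nf_christoffel (Fx C) I Ft v * nf_christoffel Ft (Fx C) J v
  + \sum_C \sum_D nf_christoffel (Fz C) I (Fz D) v * nf_christoffel (Fz D) (Fz C) J v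
  + \sum_C nf_christoffel (Fz C) I Ft v * nf_christoffel Ft (Fz C) J v
  + \sum_D nf_christoffel Ft I (Fx D) v * nf_christoffel (Fx D) Ft J v
  + \sum_D nf_christoffel Ft I (Fz D) v * nf_christoffel (Fz D) Ft J v
  + nf_christoffel Ft I Ft v * nf_christoffel Ft Ft J v.
Proof.
have xz C D : nf_christoffel (Fx C) I (Fz D) v = 0 by case: I.
have xz' C D : nf_christoffel (Fx C) (Fz D) J v = 0 by case: J.
under eq_bigr => k _ do rewrite (sum_frame (fun K => nf_christoffel (frame_of k) I K v *
                nf_christoffel K (frame_of k) J v)).
rewrite (sum_frame (fun K => \sum_A nf_christoffel K I (Fx A) v * nf_christoffel (Fx A) K J v +
  \sum_A nf_christoffel K I (Fz A) v * nf_christoffel (Fz A) K J v +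
  nf_christoffel K I Ft v * nf_christoffel Ft K J v)).
under eq_bigr => C _ do under [X in _ + X + _]eq_bigr => D _ do rewrite xz mul0r.
under [X in _ + X + _]eq_bigr => C _ do
  under [X in X + _ + _]eq_bigr => D _ do rewrite xz' mulr0.
rewrite !big_split /= !big1_eq; ring.
Qed.

(** The quadratic term G^k_il G^l_kj.  In the (x, x) component the exterior
    derivative of [a] enters once with each sign, and the products b_A b_B
    cancel against those in [nf_k]. *)
Lemma nf_quadratic_value v : (forall A, \sum_C gt C C A (base_point v) = 0) ->
  (forall A B C, gt C A B (base_point v) = gt C B A (base_point v)) ->
  (forall A B, W A B (base_point v) = W B A (base_point v)) ->
  forall I J,
  \sum_k \sum_l nf_christoffel (frame_of k) I (frame_of l) v *
                nf_christoffel (frame_of l) (frame_of k) J v =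
  match I, J with
  | Fx A, Fx B =>
      2 * (\sum_C \sum_D gt C A D (base_point v) * gt D C B (base_point v))
      + 4 * Lam * nf_bgam A B v - 2 * Lam * nf_s A B v - 2 * Lam * nf_h A B v
  | Fx A, Ft | Ft, Fx A => 2 * Lam * nf_b A v
  | Ft, Ft => 2 * n%:R
  | _, _ => 0
  end.
Proof.
move=> tr0 sym symW I J; rewrite nf_quadratic_split.
have tr0' A : \sum_C gt C A C (base_point v) = 0.
  by rewrite -[RHS](tr0 A); apply: eq_bigr => C _; exact: sym.
case: I J => [A|A|] [B|B|] /=; rewrite ?sum_mul0 ?mul0r ?mulr0 ?addr0 ?add0r //.
- have -> : \sum_C delta C A * (Lam * (nf_bgam C B v - nf_s C B v)) =
      Lam * (nf_bgam A B v - nf_s A B v) by rewrite sum_delta.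
  have -> : \sum_C (nf_da A C v - nf_da C A v - 2 * nf_k C A v) *
        (2^-1 * Lam * delta C B) =
      (nf_da A B v - nf_da B A v - 2 * nf_k B A v) * (2^-1 * Lam).
    by under eq_bigr do rewrite mulrA; rewrite sum_delta.
  have -> : \sum_D Lam * (nf_bgam A D v - nf_s A D v) * delta D B =
      Lam * (nf_bgam A B v - nf_s A B v) by rewrite sum_delta.
  have -> : \sum_D 2^-1 * Lam * delta A D *
        (nf_da B D v - nf_da D B v - 2 * nf_k D B v) =
      2^-1 * Lam * (nf_da B A v - nf_da A B v - 2 * nf_k A B v).
    by under eq_bigr do rewrite -mulrA; rewrite -mulr_sumr sum_delta.
  have -> : \sum_C \sum_D (- gt D A C (base_point v) - Lam * nf_b C v * delta A D) *
        (- gt C D B (base_point v) - Lam * nf_b D v * delta C B) =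
      \sum_C \sum_D gt C A D (base_point v) * gt D C B (base_point v) +
      2 * Lam * nf_bgam A B v + Lam ^+ 2 * nf_b A v * nf_b B v.
    have dist C D : (- gt D A C (base_point v) - Lam * nf_b C v * delta A D) *
        (- gt C D B (base_point v) - Lam * nf_b D v * delta C B) =
      gt D A C (base_point v) * gt C D B (base_point v) +
      Lam * (nf_b D v * gt D A C (base_point v)) * delta C B +
      delta A D * (Lam * (nf_b C v * gt C D B (base_point v))) +
      delta A D * (Lam ^+ 2 * nf_b C v * nf_b D v * delta C B) by ring.
    under eq_bigr do under eq_bigr do rewrite dist.
    under eq_bigr do rewrite !big_split /= !sum_delta -mulr_suml.
    rewrite !big_split /= !sum_delta exchange_big /= -!mulr_sumr.
    by rewrite -/(nf_bgam A B v); ring.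
  have kh : nf_k B A v = nf_k A B v.
    rewrite /nf_k /nf_h.
    rewrite symW; congr (- (_ + _) + _); last by ring.
    by apply: eq_bigr => C _; rewrite sym.
  by rewrite kh /nf_k; field.
- rewrite sum_deltal; under eq_bigr do rewrite mulrN.
  by rewrite sumrN sum_deltarC subrr.
- under eq_bigr do rewrite sum_delta.
  rewrite tr0' sum_delta; under eq_bigr do under eq_bigr do rewrite mulrN.
  under eq_bigr do rewrite sumrN sum_deltarC opprB opprK addrC.
  by rewrite big_split /= tr0' sum_delta; ring.
- under eq_bigr do rewrite mulNr.
  by rewrite sumrN sum_deltalC sum_deltar addNr.
- under eq_bigr do rewrite sum_delta.
  rewrite tr0 sum_delta; under eq_bigr do under eq_bigr do rewrite mulNr.
  under eq_bigr do rewrite sumrN sum_deltal opprB opprK addrC.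
  by rewrite big_split /= tr0 sum_delta; ring.
- under eq_bigr do rewrite sum_delta /delta eqxx.
  under [X in _ + X]eq_bigr do under eq_bigr do rewrite mulrNN.
  under [X in _ + X]eq_bigr do rewrite sum_delta /delta eqxx.
  by rewrite !sumr_const card_ord mulr_natl mulr2n.
Qed.

(** The last hypothesis is the (x, x) component of the Einstein equation, which
    is an equation on the base; the other components hold for any
    symmetric trace-free [gt]. *)
Lemma ricci_nf_matrix (U : set 'rV[R]_(n + n + 1)) (V : set 'rV[R]_n)
  (G : 'rV[R]_(n + n + 1) -> 'M[R]_(n + n + 1)) v :
  open U -> open V -> (forall y, U y -> V (base_point y)) -> U v ->
  (forall y, U y -> G y = nf_matrix y) ->
  (forall x, V x -> coefs_derivable x) ->
  (forall x, V x -> forall A, \sum_C gt C C A x = 0) ->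
  (forall x, V x -> forall A B C, gt C A B x = gt C B A x) ->
  (forall A B, W A B (base_point v) = W B A (base_point v)) ->
  (forall A B, ricci (fun x C A B => gt C A B x) (base_point v) A B =
     (n%:R - 1) * Lam * (nf_s A B v - \sum_D a D (base_point v) * gt D A B (base_point v)
                       - W A B (base_point v))) ->
  ricci (levi_civita G) v = (2 * n%:R * Lam) *: G v.
Proof.
move=> oU oV UV Uv GE dc tr0 sym symW ein.
have Vv := UV _ Uv.
have dtr0 A B : \sum_C partial A (gt C C B) (base_point v) = 0.
  have [dgt _ _] := dc _ Vv.
  have <- : partial A (fun x => \sum_C gt C C B x) (base_point v) =
            \sum_C partial A (gt C C B) (base_point v).
    apply: partialE; apply: is_derive_bigsum => C.
    by apply: is_derive_partial; exact: dgt.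
  rewrite (@partial_local _ _ V A _ (fun=> 0)) //.
    by apply: partialE; exact: is_derive_const.
  by move=> x Vx; exact: tr0.
have dtr0' A B : \sum_C partial B (gt C A C) (base_point v) = 0.
  rewrite -[RHS](dtr0 B A); apply: eq_bigr => C _.
  by apply: (@partial_local _ _ V) => // x Vx; exact: sym.
pose Ch : christoffel R (n + n + 1) :=
  fun y k i j => nf_christoffel (frame_of k) (frame_of i) (frame_of j) y.
have -> : ricci (levi_civita G) v = ricci Ch v.
  apply: (ricci_local oU Uv) => y Uy k i j.
  exact: (levi_civita_nf_matrix oU Uy (dc _ (UV _ Uy)) GE).
apply/matrixP => i j; rewrite (ricci_trace_free oU Uv); last 2 first.
- by move=> y j' /UV Vy; apply: nf_christoffel_trace; [exact: tr0|exact: sym].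
- by move=> i' j' k; rewrite -[i']frame_ofK; apply: derivable_nf_christoffel_trace; exact: dc.
rewrite GE // !mxE.
have dCh k : partial k (fun y => Ch y k i j) v =
    nf_dchristoffel (frame_of k) (frame_of i) (frame_of j) v.
  apply: partialE; rewrite -{1}[k]frame_ofK.
  by apply: is_derive_nf_christoffel; exact: dc.
under eq_bigr do rewrite dCh.
rewrite nf_divergence ?nf_quadratic_value //; try by [exact: tr0|exact: sym].
move: (frame_of i) (frame_of j) => [A|A|] [B|B|] /=; try by field.
(* By the definition of h, - z_D gt^D_AB = h_AB + W_AB. *)
have bE : nf_bgam A B v =
    \sum_D a D (base_point v) * gt D A B (base_point v) + nf_h A B v + W A B (base_point v).
  rewrite /nf_h opprD addrA subrK /nf_bgam -sumrB; apply: eq_bigr => D _.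
  by rewrite /nf_b; ring.
have := ein A B; rewrite (ricci_trace_free oV Vv); first last.
- by move=> i' j' k; have [dgt _ _] := dc _ Vv; exact: dgt.
- by move=> x B' Vx; exact: tr0.
move=> /eqP; rewrite subr_eq => /eqP ->; rewrite bE; ring.
Qed.

End NormalForm.

(** * The projective change to a trace-free connection *)

Section Smooth.
Variables (R : realType) (m : nat) (V : set 'rV[R]_m).
Implicit Types (f : 'rV[R]_m -> R) (x : 'rV[R]_m).

Lemma smooth_on_derivable f i x : smooth_on V f -> V x ->
  derivable f x (delta_mx 0 i).
Proof. by move=> sf Vx; have [_ /(_ i)[df _]] := sf 1%N; exact: df. Qed.

Lemma smooth_on_partial f i : smooth_on V f -> smooth_on V (partial i f).
Proof. by move=> sf k; have [_ /(_ i)[_]] := sf k.+1. Qed.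

Lemma derivable_bigsum p (h : 'I_p -> 'rV[R]_m -> R) x d :
  (forall i, derivable (h i) x d) ->
  derivable (fun y => \sum_i h i y) x d.
Proof.
by move=> dh; have [] := is_derive_bigsum (fun i => derivableP (dh i)).
Qed.

Lemma derivable_mul f g x d : derivable f x d -> derivable g x d ->
  derivable (fun y => f y * g y) x d.
Proof. by move=> /derivableP df /derivableP dg; have [] := is_derive_mul df dg. Qed.

Lemma derivable_scale (c : R) f x d : derivable f x d ->
  derivable (fun y => c * f y) x d.
Proof. by move=> df; have [] := is_derive_scale c (derivableP df). Qed.

Lemma derivable_add f g x d : derivable f x d -> derivable g x d ->
  derivable (fun y => f y + g y) x d.
Proof. by move=> /derivableP df /derivableP dg; have [] := is_derive_add df dg. Qed.

Lemma derivable_sub f g x d : derivable f x d -> derivable g x d ->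
  derivable (fun y => f y - g y) x d.
Proof.
move=> /derivableP df /derivableP dg.
by have [] := is_derive_add df (is_derive_opp dg).
Qed.

Lemma derivable_ricci (Gam : christoffel R m) x i A B :
  (forall C A B, smooth_on V (fun y => Gam y C A B)) -> V x ->
  derivable (fun y => ricci Gam y A B) x (delta_mx 0 i).
Proof.
move=> sG Vx.
have -> : (fun y => ricci Gam y A B) = fun y =>
   (\sum_C partial C (fun y => Gam y C A B) y
    - \sum_C partial A (fun y => Gam y C C B) y
    + \sum_C \sum_D Gam y C C D * Gam y D A B
    - \sum_C \sum_D Gam y C A D * Gam y D C B).
  by apply/funext => y; rewrite mxE.
have dG C A' B' : derivable (fun y => Gam y C A' B') x (delta_mx 0 i).
  by apply: smooth_on_derivable; first exact: sG.
have dpG C A' B' D : derivable (partial D (fun y => Gam y C A' B')) x (delta_mx 0 i).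
  by apply: smooth_on_derivable; first by apply: smooth_on_partial; exact: sG.
apply: derivable_sub; first (apply: derivable_add; first apply: derivable_sub).
- by apply: derivable_bigsum => C; exact: dpG.
- by apply: derivable_bigsum => C; exact: dpG.
- by do 2 (apply: derivable_bigsum => ?); apply: derivable_mul; exact: dG.
- by do 2 (apply: derivable_bigsum => ?); apply: derivable_mul; exact: dG.
Qed.

End Smooth.

Section ProjectiveChange.
Variables (R : realType) (n : nat) (n_ge2 : (2 <= n)%N) (Lam : R) (Lam_neq0 : Lam != 0).
Variables (Gam : christoffel R n) (V : set 'rV[R]_n) (oV : open V).
Hypothesis Gam_smooth : forall C A B, smooth_on V (fun x => Gam x C A B).
Hypothesis Gam_sym : forall x, V x -> forall C A B, Gam x C A B = Gam x C B A.
Implicit Types (x : 'rV[R]_n) (A B C D : 'I_n).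

Definition trace_form A x : R := (\sum_C Gam x C A C) / (Lam * (n%:R + 1)).

(** The projective change of [Gam] by the one-form - Lam [trace_form]; it is the
    representative of the projective class that preserves the coordinate volume. *)
Definition special_gam C A B x : R :=
  Gam x C A B - Lam * ((C == A)%:R * trace_form B x + (C == B)%:R * trace_form A x).

(** Only this part of the Schouten tensor enters the metric, because
    dx^A . dx^B is symmetric. *)
Definition sym_schouten x A B : R :=
  (n%:R - 1)^-1 * (2^-1 * (ricci Gam x A B + ricci Gam x B A)).

Definition residual A B x : R :=
  Lam * trace_form A x * trace_form B x - Lam^-1 * sym_schouten x A B.

Let n1_neq0 : n%:R + 1 != 0 :> R.
Proof. by rewrite natr1 pnatr_eq0. Qed.

Let nB1_neq0 : n%:R - 1 != 0 :> R.
Proof. by rewrite subr_eq0 pnatr_eq1; case: n n_ge2 => [|[]]. Qed.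

Lemma sum_trace_form A x : \sum_C Gam x C A C = Lam * (n%:R + 1) * trace_form A x.
Proof. by rewrite /trace_form mulrC divfK // mulf_neq0. Qed.

Lemma special_gam_sym x : V x -> forall A B C,
  special_gam C A B x = special_gam C B A x.
Proof. by move=> Vx A B C; rewrite /special_gam Gam_sym // [X in Lam * X]addrC. Qed.

Lemma special_gam_trace x : V x -> forall A, \sum_C special_gam C C A x = 0.
Proof.
move=> Vx A; rewrite sumrB -mulr_sumr big_split /= sum_delta.
have -> : \sum_C Gam x C C A = Lam * (n%:R + 1) * trace_form A x.
  by rewrite -sum_trace_form; apply: eq_bigr => C _; exact: Gam_sym.
under eq_bigr do rewrite eqxx mul1r.
by rewrite sumr_const card_ord -mulr_natl; ring.
Qed.

Lemma residual_sym x A B : residual A B x = residual B A x.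
Proof.
rewrite /residual /sym_schouten [ricci _ _ A B + _]addrC.
by rewrite mulrAC.
Qed.

Lemma derivable_Gam x i C A B : V x ->
  derivable (fun y => Gam y C A B) x (delta_mx 0 i).
Proof. by move=> Vx; apply: smooth_on_derivable; first exact: Gam_smooth. Qed.

Lemma is_derive_trace_form x i A : V x ->
  is_derive x (delta_mx 0 i) (trace_form A)
    ((\sum_C partial i (fun y => Gam y C A C) x) / (Lam * (n%:R + 1))).
Proof.
move=> Vx; apply: is_derive_scaler; apply: is_derive_bigsum => C.
by apply: is_derive_partial; exact: derivable_Gam.
Qed.

Lemma is_derive_special_gam x i C A B : V x ->
  is_derive x (delta_mx 0 i) (special_gam C A B)
    (partial i (fun y => Gam y C A B) x
     - Lam * ((C == A)%:R * partial i (trace_form B) x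
            + (C == B)%:R * partial i (trace_form A) x)).
Proof.
move=> Vx; have da A' : derivable (trace_form A') x (delta_mx 0 i).
  by have [] := is_derive_trace_form i A' Vx.
apply: is_derive_add.
  by apply: is_derive_partial; exact: derivable_Gam.
apply: is_derive_opp; apply: is_derive_scale.
by apply: is_derive_add; apply: is_derive_scale; exact: is_derive_partial.
Qed.

Lemma special_coefs_derivable x : V x ->
  coefs_derivable special_gam trace_form residual x.
Proof.
move=> Vx; have da D A : derivable (trace_form A) x (delta_mx 0 D).
  by have [] := is_derive_trace_form D A Vx.
split=> [D C A B|//|D A B].
  by have [] := is_derive_special_gam D C A B Vx.
have dR A' B' : derivable (fun y => ricci Gam y A' B') x (delta_mx 0 D).
  exact: (@derivable_ricci _ _ V Gam x D A' B' Gam_smooth Vx).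
apply: (derivable_sub (f := fun y => Lam * trace_form A y * trace_form B y)).
  by apply: derivable_mul => //; exact: derivable_scale.
exact/derivable_scale/derivable_scale/derivable_scale/derivable_add.
Qed.

(** Torsion-freeness turns both traces Gamma^C_CB and Gamma^C_BC into multiples
    of the trace form. *)
Lemma sym_schoutenE x : V x -> forall A B,
  (n%:R - 1) * sym_schouten x A B =
  \sum_C partial C (fun y => Gam y C A B) x
  - Lam * (n%:R + 1) * (2^-1 * (partial A (trace_form B) x + partial B (trace_form A) x))
  + Lam * (n%:R + 1) * (\sum_D trace_form D x * Gam x D A B)
  - \sum_C \sum_D Gam x C A D * Gam x D C B.
Proof.
move=> Vx A B; rewrite /sym_schouten mulVKf //.
have dtr A' B' : \sum_C partial A' (fun y => Gam y C C B') x =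
    Lam * (n%:R + 1) * partial A' (trace_form B') x.
  rewrite (partialE (is_derive_trace_form A' B' Vx)) [RHS]mulrC divfK ?mulf_neq0 //.
  apply: eq_bigr => C _; apply: (@partial_local _ _ V) => // y Vy.
  exact: Gam_sym.
have tr A' B' : \sum_C \sum_D Gam x C C D * Gam x D A' B' =
    Lam * (n%:R + 1) * \sum_D trace_form D x * Gam x D A' B'.
  rewrite exchange_big mulr_sumr; apply: eq_bigr => D _ /=.
  rewrite -mulr_suml mulrA -sum_trace_form; congr (_ * _).
  by apply: eq_bigr => C _; exact: Gam_sym.
have dsym : \sum_C partial C (fun y => Gam y C B A) x =
            \sum_C partial C (fun y => Gam y C A B) x.
  apply: eq_bigr => C _; apply: (@partial_local _ _ V) => // y Vy.
  exact: Gam_sym.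
have gsym : \sum_D trace_form D x * Gam x D B A =
            \sum_D trace_form D x * Gam x D A B.
  by apply: eq_bigr => D _; rewrite Gam_sym.
have qsym : \sum_C \sum_D Gam x C B D * Gam x D C A =
            \sum_C \sum_D Gam x C A D * Gam x D C B.
  rewrite exchange_big; apply: eq_bigr => C _; apply: eq_bigr => D _ /=.
  by rewrite mulrC Gam_sym // [in X in _ * X]Gam_sym.
rewrite [ricci _ _ A B]mxE [ricci _ _ B A]mxE (dtr A B) (dtr B A).
rewrite (tr A B) (tr B A) dsym gsym qsym.
by field.
Qed.

Lemma special_gam_quadratic x : V x -> forall A B,
  \sum_C \sum_D special_gam C A D x * special_gam D C B x =
  \sum_C \sum_D Gam x C A D * Gam x D C B
  - 2 * Lam * (\sum_D trace_form D x * Gam x D A B)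
  - (n%:R - 1) * Lam ^+ 2 * trace_form A x * trace_form B x.
Proof.
move=> Vx A B.
have dist C D : special_gam C A D x * special_gam D C B x =
  Gam x C A D * Gam x D C B
  - Lam * trace_form B x * (Gam x C A D * (D == C)%:R)
  - Lam * (trace_form C x * Gam x C A D * (D == B)%:R)
  - Lam * ((C == A)%:R * (trace_form D x * Gam x D C B))
  - Lam * trace_form A x * ((C == D)%:R * Gam x D C B)
  + Lam ^+ 2 * trace_form B x * ((C == A)%:R * (trace_form D x * (D == C)%:R))
  + Lam ^+ 2 * ((C == A)%:R * (trace_form D x * trace_form C x * (D == B)%:R))
  + Lam ^+ 2 * trace_form A x * trace_form B x * ((C == D)%:R * (D == C)%:R)
  + Lam ^+ 2 * trace_form A x * ((C == D)%:R * (trace_form C x * (D == B)%:R)).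
  by rewrite /special_gam; ring.
under eq_bigr do under eq_bigr do rewrite dist.
under eq_bigr do rewrite !(sumrB, big_split) /= -!mulr_sumr !sum_delta eqxx.
rewrite !(sumrB, big_split) /= -!mulr_sumr !sum_delta.
have -> : \sum_C Gam x C C B = Lam * (n%:R + 1) * trace_form B x.
  by rewrite -sum_trace_form; apply: eq_bigr => C _; exact: Gam_sym.
by rewrite sum_trace_form sumr_const card_ord; ring.
Qed.

(** The transformation law of the Schouten tensor under a projective change
    Upsilon, P~ = P - nabla Upsilon + Upsilon Upsilon, with Upsilon = - Lam a.
    It is written with the covariant derivative of the new connection, since
    this is the form in which the Ricci tensor of the metric contains it. *)
Lemma ricci_special_gam x : V x -> forall A B,
  ricci (fun y C A B => special_gam C A B y) x A B =
  (n%:R - 1) * Lam *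
    (2^-1 * (partial A (trace_form B) x + partial B (trace_form A) x)
     - \sum_D trace_form D x * special_gam D A B x - residual A B x).
Proof.
move=> Vx A B; rewrite (ricci_trace_free oV Vx); first last.
- by move=> i j k; have [dg _ _] := special_coefs_derivable Vx; exact: dg.
- by move=> y j Vy; exact: special_gam_trace.
rewrite special_gam_quadratic //.
have -> : \sum_C partial C (fun y => special_gam C A B y) x =
  \sum_C partial C (fun y => Gam y C A B) x
  - Lam * (partial A (trace_form B) x + partial B (trace_form A) x).
  under eq_bigr do rewrite (partialE (is_derive_special_gam _ _ _ _ Vx)).
  by rewrite sumrB -mulr_sumr big_split /= !sum_delta.
have -> : \sum_D trace_form D x * special_gam D A B x =
  \sum_D trace_form D x * Gam x D A B - 2 * Lam * trace_form A x * trace_form B x.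
  have dist D : trace_form D x * special_gam D A B x =
    trace_form D x * Gam x D A B
    - Lam * trace_form B x * (trace_form D x * (D == A)%:R)
    - Lam * trace_form A x * (trace_form D x * (D == B)%:R).
    by rewrite /special_gam; ring.
  under eq_bigr do rewrite dist.
  by rewrite !sumrB -!mulr_sumr !sum_delta; ring.
have := sym_schoutenE Vx A B.
move: (\sum_C partial C _ x) (\sum_C \sum_D _) (\sum_D _ * Gam x D A B) => S1 S2 S3.
move=> E; have -> : S1 = (n%:R - 1) * sym_schouten x A B + S2 -
  Lam * (n%:R + 1) * S3 +
  Lam * (n%:R + 1) * (2^-1 * (partial A (trace_form B) x + partial B (trace_form A) x)).
  by rewrite E; ring.
by rewrite /residual; field.
Qed.

End ProjectiveChange.

(** * The circle bundle metric in coordinates *)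

Section Identification.
Variables (R : realType) (n : nat) (n_ge2 : (2 <= n)%N) (Lam : R) (Lam_neq0 : Lam != 0).
Variable (Gam : christoffel R n).
Implicit Types (x z : 'rV[R]_n) (A B C D : 'I_n).

Lemma odotE m (a b : 'rV[R]_m) i j :
  odot a b i j = 2^-1 * (a 0 i * b 0 j + b 0 i * a 0 j).
Proof. by rewrite !mxE !big_ord1 !mxE. Qed.

Lemma dx_l A B : dx R A 0 (lshift n B) = (A == B)%:R.
Proof. by rewrite mxE eqxx /= (inj_eq (@lshift_inj _ _)) eq_sym. Qed.

Lemma dx_r A B : dx R A 0 (rshift n B) = 0.
Proof. by rewrite mxE /= eq_rlshift. Qed.

Lemma dz_l A B : dz R A 0 (lshift n B) = 0.
Proof. by rewrite mxE /= eq_lrshift. Qed.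

Lemma dz_r A B : dz R A 0 (rshift n B) = (A == B)%:R.
Proof. by rewrite mxE eqxx /= (inj_eq (@rshift_inj _ _)) eq_sym. Qed.

Definition dE := (dx_l, dx_r, dz_l, dz_r).

Lemma schouten_sym_part x A B :
  2^-1 * (schouten Gam x A B + schouten Gam x B A) = sym_schouten Gam x A B.
Proof.
rewrite /schouten /sym_schouten; move: (ricci Gam x) => Rc.
rewrite !mxE; field.
by rewrite natr1 pnatr_eq0 subr_eq0 pnatr_eq1; case: n n_ge2 => [|[]].
Qed.

Lemma potential_l x z A :
  potential Lam Gam x z 0 (lshift n A) = z 0 A - trace_form Lam Gam A x.
Proof.
rewrite /potential !mxE !summxE; congr (_ - _).
  by under eq_bigr do rewrite mxE dE; rewrite sum_delta.
by under eq_bigr do rewrite mxE dE -mulr_suml; rewrite sum_delta.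
Qed.

Lemma potential_r x z A : potential Lam Gam x z 0 (rshift n A) = 0.
Proof.
rewrite /potential !mxE !summxE !big1 ?subr0 // => B _;
  by rewrite mxE dE mulr0.
Qed.

Let metric_coef x z A B := \sum_C Gam x C A B * z 0 C
   - Lam * z 0 A * z 0 B - Lam^-1 * schouten Gam x A B.

Lemma g_Lambda_ll x z A B :
  g_Lambda Lam Gam x z (lshift n A) (lshift n B) =
  - (2^-1 * (metric_coef x z A B + metric_coef x z B A)).
Proof.
rewrite /g_Lambda !mxE !summxE big1 => [|D _]; last first.
  by rewrite odotE !dE; ring.
rewrite add0r; congr (- _).
have entry C : (\sum_D metric_coef x z C D *: odot (dx R C) (dx R D))
    (lshift n A) (lshift n B) =
    2^-1 * ((C == A)%:R * metric_coef x z C B +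
            (C == B)%:R * metric_coef x z C A).
  rewrite summxE.
  have dist D : (metric_coef x z C D *: odot (dx R C) (dx R D))
      (lshift n A) (lshift n B) =
      2^-1 * (C == A)%:R * (metric_coef x z C D * (D == B)%:R) +
      2^-1 * (C == B)%:R * (metric_coef x z C D * (D == A)%:R).
    by rewrite mxE odotE !dE; ring.
  under eq_bigr do rewrite dist.
  by rewrite big_split /= -!mulr_sumr !sum_delta; ring.
by under eq_bigr do rewrite entry; rewrite -mulr_sumr big_split /= !sum_delta.
Qed.

Lemma g_Lambda_lr x z A B :
  g_Lambda Lam Gam x z (lshift n A) (rshift n B) = 2^-1 * (A == B)%:R.
Proof.
rewrite /g_Lambda !mxE !summxE [X in _ - X]big1 => [|C _]; last first.
  by rewrite summxE big1 // => D _; rewrite mxE odotE !dE; ring.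
rewrite subr0.
have dist D : odot (dz R D) (dx R D) (lshift n A) (rshift n B) =
    2^-1 * ((D == A)%:R * (D == B)%:R) by rewrite odotE !dE; ring.
by under eq_bigr do rewrite dist; rewrite -mulr_sumr sum_delta eq_sym.
Qed.

Lemma g_Lambda_rl x z A B :
  g_Lambda Lam Gam x z (rshift n A) (lshift n B) = 2^-1 * (A == B)%:R.
Proof.
rewrite /g_Lambda !mxE !summxE [X in _ - X]big1 => [|C _]; last first.
  by rewrite summxE big1 // => D _; rewrite mxE odotE !dE; ring.
rewrite subr0.
have dist D : odot (dz R D) (dx R D) (rshift n A) (lshift n B) =
    2^-1 * ((D == A)%:R * (D == B)%:R) by rewrite odotE !dE; ring.
by under eq_bigr do rewrite dist; rewrite -mulr_sumr sum_delta eq_sym.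
Qed.

Lemma g_Lambda_rr x z A B :
  g_Lambda Lam Gam x z (rshift n A) (rshift n B) = 0.
Proof.
rewrite /g_Lambda !mxE !summxE !big1 ?subr0 // => C _.
  by rewrite summxE big1 // => D _; rewrite mxE odotE !dE; ring.
by rewrite odotE !dE; ring.
Qed.

Definition connection_form (v : 'rV[R]_(n + n + 1)) : 'rV[R]_(n + n + 1) :=
  Lam^-1 *: dt R n +
  pull_form (potential Lam Gam (lsubmx (lsubmx v)) (rsubmx (lsubmx v))).

Lemma connection_formE v k : connection_form v 0 k =
  match frame_of k with
  | Fx A => fibre_z v A - trace_form Lam Gam A (base_point v)
  | Fz _ => 0
  | Ft => Lam^-1
  end.
Proof.
rewrite -{1}[k]frame_ofK; case: (frame_of k) => [A|A|] /=.
- rewrite 3!mxE /= /ix eq_lrshift mulr0 add0r row_mxEl.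
  exact: potential_l.
- rewrite 3!mxE /= /iz eq_lrshift mulr0 add0r row_mxEl.
  exact: potential_r.
- by rewrite 3!mxE /= /it eqxx mulr1 row_mxEr mxE addr0.
Qed.

(** The terms Lam z_A z_B of the base metric and of the square of the connection
    form cancel; the cross terms z_A a_B change the connection projectively. *)
Lemma circle_metricE v :
  (forall C A B, Gam (base_point v) C A B = Gam (base_point v) C B A) ->
  pull_tensor (g_Lambda Lam Gam (lsubmx (lsubmx v)) (rsubmx (lsubmx v)))
    - Lam *: odot (connection_form v) (connection_form v) =
  nf_matrix Lam (special_gam Lam Gam) (trace_form Lam Gam) (residual Lam Gam) v.
Proof.
move=> sym.
apply/matrixP => i j; rewrite [LHS]mxE [X in _ + X]mxE [X in - X]mxE odotE.
rewrite !connection_formE [RHS]mxE.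
rewrite -{1}[i]frame_ofK -{1}[j]frame_ofK.
case: (frame_of i) => [A|A|]; case: (frame_of j) => [B|B|] /=;
  rewrite /pull_tensor /ix /iz /it.
- rewrite block_mxEul g_Lambda_ll /metric_coef /nf_h /residual -schouten_sym_part.
  have -> : \sum_C special_gam Lam Gam C A B (base_point v) * fibre_z v C =
     \sum_C Gam (base_point v) C A B * fibre_z v C
     - Lam * (fibre_z v A * trace_form Lam Gam B (base_point v)
            + fibre_z v B * trace_form Lam Gam A (base_point v)).
    have dist C : special_gam Lam Gam C A B (base_point v) * fibre_z v C =
      Gam (base_point v) C A B * fibre_z v C
      - Lam * trace_form Lam Gam B (base_point v) * (fibre_z v C * (C == A)%:R)
      - Lam * trace_form Lam Gam A (base_point v) * (fibre_z v C * (C == B)%:R).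
      by rewrite /special_gam; ring.
    under eq_bigr do rewrite dist.
    by rewrite !sumrB -!mulr_sumr !sum_delta; ring.
  rewrite -/(base_point v) -!/(fibre_z v _).
  have -> : \sum_C Gam (base_point v) C B A * rsubmx (lsubmx v) 0 C =
            \sum_C Gam (base_point v) C A B * fibre_z v C.
    by apply: eq_bigr => C _; rewrite sym.
  by field.
- by rewrite block_mxEul g_Lambda_lr; ring.
- by rewrite block_mxEur mxE /nf_b; field.
- by rewrite block_mxEul g_Lambda_rl; ring.
- by rewrite block_mxEul g_Lambda_rr; ring.
- by rewrite block_mxEur mxE; ring.
- by rewrite block_mxEdl mxE /nf_b; field.
- by rewrite block_mxEdl mxE; ring.
- by rewrite block_mxEdr mxE; field.
Qed.

End Identification.

Theorem theorem7p3 (R : realType) (n : nat) (n_ge2 : (2 <= n)%N)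
  (N : manifold R n)
  (P : set (affine_connection N)) (P_proj : projective_structure P)
  (nabla : affine_connection N) (nabla_in_P : P nabla)
  (Lambda : R) (Lambda_neq0 : Lambda != 0)
  (M : manifold R (n + n)) (cM : cotangent_bundle N M)
  (g : sym_tensor M)
  (g_def : forall (i : chart_index N) (w : 'rV[R]_(n + n)),
     cimg (ctidx cM i) w ->
     tensor_comp g (ctidx cM i) w =
       g_Lambda Lambda (gam nabla i) (lsubmx w) (rsubmx w))
  (Q : manifold R (n + n + 1)) (sigma : circle_bundle cM Q)
  (theta : one_form Q)
  (theta_def : forall (j : chart_index Q) (v : 'rV[R]_(n + n + 1)), cimg j v ->
     form_comp theta j v =
       Lambda^-1 *: dt R n +
       pull_form (potential Lambda (gam nabla (tidx sigma j))
                    (lsubmx (lsubmx v)) (rsubmx (lsubmx v))))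
  (G : sym_tensor Q)
  (G_def : forall (j : chart_index Q) (v : 'rV[R]_(n + n + 1)), cimg j v ->
     tensor_comp G j v =
       pull_tensor (tensor_comp g (ctidx cM (tidx sigma j)) (lsubmx v)) -
       Lambda *: odot (form_comp theta j v) (form_comp theta j v)) :
  [/\ nondegenerate_metric G,
      einstein G
    & forall (j : chart_index Q) (v : 'rV[R]_(n + n + 1)), cimg j v ->
        ricci_scalar G j v = (2 * n * (2 * n + 1))%:R * Lambda].
Proof.
have sym j x : cimg j x -> forall C A B, gam nabla j x C A B = gam nabla j x C B A.
  have tf : torsion_free nabla.
    by case: P_proj => D0 _ PE; move: nabla_in_P; rewrite PE => -[].
  by move=> jx C A B; exact: tf.
have fibre j v : cimg j v -> cimg (ctidx cM (tidx sigma j)) (lsubmx v).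
  rewrite (timgE sigma) => -[[p tp <-] _].
  by exists p => //; exact: (tbase_sub tp).
have base j v : cimg j v -> cimg (tidx sigma j) (base_point v).
  by move=> /fibre; rewrite ctimgE.
have GE j v : cimg j v -> tensor_comp G j v =
    let Gam := gam nabla (tidx sigma j) in
    nf_matrix Lambda (special_gam Lambda Gam) (trace_form Lambda Gam)
              (residual Lambda Gam) v.
  move=> jv; rewrite /= -circle_metricE //; last exact/sym/base.
  by rewrite G_def // theta_def // g_def //; exact: fibre.
have unitG : nondegenerate_metric G.
  by move=> j v jv; rewrite GE //; exact: nf_matrix_unit.
have ricG j v : cimg j v ->
    metric_ricci G j v = (2 * n%:R * Lambda) *: tensor_comp G j v.
  move=> jv; have oV : open (cimg (tidx sigma j)) by exact: cimg_open.
  have sG C A B : smooth_on (cimg (tidx sigma j))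
      (fun x => gam nabla (tidx sigma j) x C A B) by exact: gam_smooth.
  have sy := @sym (tidx sigma j).
  have oU : open (cimg j) by exact: cimg_open.
  rewrite /metric_ricci.
  apply: (ricci_nf_matrix Lambda_neq0 oU oV _ jv (@GE j)) => [y||||A B|A B].
  - exact: base.
  - by move=> x Vx; exact: (special_coefs_derivable _ sG).
  - by move=> x Vx; exact: (special_gam_trace Lambda_neq0 sy Vx).
  - by move=> x Vx; exact: (special_gam_sym _ sy).
  - exact: residual_sym.
  - exact: (ricci_special_gam n_ge2 Lambda_neq0 oV sG sy (base _ _ jv)).
split; [exact: unitG | by exists (2 * n%:R * Lambda); exact: ricG |].
move=> j v jv; rewrite /ricci_scalar ricG // -scalemxAr mulVmx ?unitG //.
by rewrite mxtraceZ mxtrace1 !(natrM, natrD); ring.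
Qed.
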